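(* If $\mathcal{U}$ is a Laver ultrafilter, then $\mathcal{U}$ is a $\mathcal{Y}_f^0$-ultrafilter for each Yorioka ideal $\mathcal{Y}_f$ ($f\in\omega^\omega$ strictly increasing). In particular, $\mathcal{U}$ is a measure zero ultrafilter (and thus a nowhere dense ultrafilter).
   Context: By an ultrafilter we always mean a non-principal ultrafilter. Laver ultrafilter: an ultrafilter $\mathcal{U}$ over $\omega$ is a Laver ultrafilter if for every sequence $\langle \mathcal{P}_n : n\in\omega\rangle$, where each $\mathcal{P}_n$ is a partition of $\omega$ into finitely many sets, there exists $x\in\mathcal{U}$ such that for all $n\in\omega$, $x$ has non-empty intersection with at most $n+1$ elements of $\mathcal{P}_n$. For a collection $\mathcal{I}$ of subsets of a set $X$, closed under subsets and containing all singletons, an ultrafilter $\mathcal{U}$ over $\omega$ is an $\mathcal{I}$-ultrafilter if for every $F:\omega\to X$ there is $x\in\mathcal{U}$ with $F[x]\in\mathcal{I}$. With $X=2^\omega$, measure zero ultrafilters are the $\mathcal{I}$-ultrafilters for $\mathcal{I}$ the collection of sets with closure of measure zero (in the standard product measure), and nowhere dense ultrafilters are those for $\mathcal{I}$ the collection of nowhere dense sets. Yorioka ideals: for $s\in 2^{<\omega}$ let $[s]=\{x\in 2^\omega : x|_{|s|}=s\}$. For $\sigma\in(2^{<\omega})^\omega$ let $[\sigma]_\infty:=\bigcap_{n\in\omega}\bigcup_{m\ge n}[\sigma(m)]$ and $\mathrm{ht}_\sigma(i):=|\sigma(i)|$ for $i\in\omega$. For $f,g\in\omega^\omega$, $f\le^{\ast}g$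 means $f(n)\le g(n)$ for all but finitely many $n$, and $f\ll g$ means that for all $k\in\omega$, $f\circ\mathrm{pw}_k\le^{\ast}g$, where $\mathrm{pw}_k:\omega\to\omega$, $i\mapsto i^k$. For strictly increasing $f\in\omega^\omega$, $\mathcal{Y}_f:=\{X\subseteq 2^\omega : \exists\sigma\in(2^{<\omega})^\omega:\ X\subseteq[\sigma]_\infty \wedge f\ll\mathrm{ht}_\sigma\}$. $\mathcal{Y}_f^0$ denotes the ideal of those subsets of $2^\omega$ whose closure is in $\mathcal{Y}_f$. *)

(* Defs.v *)
From HB Require Import structures.
From mathcomp Require Import all_boot all_order all_algebra.
From mathcomp Require Import all_classical all_reals all_analysis measurable_realfun.
From mathcomp Require Import zify ring lra.

Set Implicit Arguments.
Unset Strict Implicit.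
Unset Printing Implicit Defensive.
Import Order.TTheory GRing.Theory Num.Theory.
Import numFieldNormedType.Exports.
Local Open Scope classical_set_scope.
Local Open Scope ring_scope.

Definition nonprincipal_ultrafilter (U : set_system nat) : Prop :=
  UltraFilter U /\ forall n, U <> principal_filter n.

Definition laver_ultrafilter (U : set_system nat) : Prop :=
  nonprincipal_ultrafilter U /\
  forall P : nat -> set (set nat),
    (forall n, finite_set (P n) /\ partition (P n) id [set: nat]) ->
    exists2 x, U x & forall n,
      ([set p | P n p /\ x `&` p !=set0] #<= `I_n.+1)%card.

Definition subset_closed_with_points (X : Type) (I : set (set X)) : Prop :=
  (forall A B, A `<=` B -> I B -> I A) /\ (forall x, I [set x]).

(* Meant for collections [I] satisfying [subset_closed_with_points]; this is
   proved below for the three instances that are used. *)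
Definition ideal_ultrafilter (X : Type) (I : set (set X))
    (U : set_system nat) : Prop :=
  nonprincipal_ultrafilter U /\
  forall F : nat -> X, exists2 x, U x & I (F @` x).

Definition cylinder (s : seq bool) : set cantor_space :=
  [set x | mkseq x (size s) = s].

Lemma cylinderP s (x : cantor_space) :
  cylinder s x <-> forall i, (i < size s)%N -> x i = nth false s i.
Proof.
split=> [<- i|h]; first by rewrite size_mkseq => ?; rewrite nth_mkseq.
apply: (@eq_from_nth _ false); rewrite size_mkseq// => i si.
by rewrite nth_mkseq// h.
Qed.

Lemma cylinder_mkseq (x : cantor_space) n : cylinder (mkseq x n) x.
Proof. by rewrite /cylinder/= size_mkseq. Qed.

Lemma nbhs_cylinder (x : cantor_space) n : nbhs x (cylinder (mkseq x n)).
Proof.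
suff : \forall y \near x, forall i, (i < n)%N -> (y : cantor_space) i = x i.
  apply: filterS => y yx; apply/cylinderP => i; rewrite size_mkseq => ni.
  by rewrite nth_mkseq// yx.
elim: n => [|n IH]; first by apply: filterE.
have xn : nbhs x (@proj _ (fun=> bool) n @^-1` [set x n]).
  by apply: (@proj_continuous _ (fun=> bool) n x); exact/principal_filterP.
apply: filterS2 IH xn => y yx ynx i; rewrite ltnS leq_eqVlt => /predU1P[->//|].
exact: yx.
Qed.

Lemma cylinder_open s : open (cylinder s).
Proof.
rewrite openE => x xs.
by have := nbhs_cylinder x (size s); rewrite xs.
Qed.

Lemma nbhs_cylinderP (x : cantor_space) A :
  nbhs x A <-> exists n, cylinder (mkseq x n) `<=` A.
Proof.
split=> [|[n] nA]; last exact: filterS nA (nbhs_cylinder x n).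
pose G := filter_from [set: nat] (fun n => cylinder (mkseq x n)).
have GF : Filter G.
  apply: filter_from_filter; first by exists 0%N.
  move=> i j _ _; exists (maxn i j) => // y /cylinderP; rewrite size_mkseq => h.
  split; apply/cylinderP => k; rewrite size_mkseq => kl.
    rewrite h ?(leq_trans kl)// ?leq_maxl// !nth_mkseq//.
    by rewrite (leq_trans kl)// leq_maxl.
  rewrite h ?(leq_trans kl)// ?leq_maxr// !nth_mkseq//.
  by rewrite (leq_trans kl)// leq_maxr.
suff : G --> x by move=> /[apply] -[n _ nA]; exists n.
apply/cvg_sup => i B /=.
have initialE (W := initial_topology (fun f : forall _ : nat, bool => f i))
    (w : W) : nbhs w B -> exists2 V : set bool, V (w i) & [set y | V (y i)] `<=` B.
  by rewrite nbhsE => -[_ [[V _ <-] Vw] VB]; exists V.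
move=> /initialE[V Vx VB].
exists i.+1 => // y /cylinderP; rewrite size_mkseq => h.
by apply: VB => /=; rewrite h// nth_mkseq//; exact: Vx.
Qed.

Definition nowhere_dense : set (set cantor_space) :=
  [set A | (closure A)^° = set0].

Definition eventually_le (f g : nat -> nat) : Prop :=
  \forall n \near \oo, (f n <= g n)%N.

Definition dominated (f g : nat -> nat) : Prop :=
  forall k, eventually_le (f \o expn^~ k) g.

Definition ht (sigma : nat -> seq bool) (i : nat) : nat := size (sigma i).

Definition yorioka (f : nat -> nat) : set (set cantor_space) :=
  [set X | exists sigma : nat -> seq bool,
    X `<=` lim_sup_set (fun m => cylinder (sigma m)) /\ dominated f (ht sigma)].

Definition yorioka0 (f : nat -> nat) : set (set cantor_space) :=
  [set X | yorioka f (closure X)].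

Definition borel_cantor := g_sigma_algebraType (@open cantor_space).

Definition binary_digits (R : realType) : measurableTypeR R -> borel_cantor :=
  fun (x : R) n => odd (Num.truncn (x * 2 ^+ n.+1)).

Lemma measurable_cylinder s :
  measurable (cylinder s : set borel_cantor).
Proof. by apply: sub_sigma_algebra; exact: cylinder_open. Qed.

Lemma open_bigcup_cylinder (A : set cantor_space) : open A ->
  exists2 F : (set cantor_space)^nat,
    A = \bigcup_k F k & forall k, F k = set0 \/ exists s, F k = cylinder s.
Proof.
rewrite openE => oA; pose c k : seq bool := odflt [::] (unpickle k).
exists (fun k => if `[< cylinder (c k) `<=` A >] then cylinder (c k) else set0).
  apply/seteqP; split=> [x /oA/nbhs_cylinderP[n nA]|x [k _]].
    exists (pickle (mkseq x n)) => //; rewrite /c pickleK/=.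
    by case: asboolP => // _; exact: cylinder_mkseq.
  by case: asboolP => // cA /cA.
by move=> k; case: ifP => _; [right; exists (c k)|left].
Qed.

Lemma cylinderI s t : (size s <= size t)%N ->
  cylinder s `&` cylinder t = if take (size s) t == s then cylinder t else set0.
Proof.
move=> st; have tk (x : cantor_space) :
    cylinder t x -> take (size s) t = mkseq x (size s).
  by move=> <-; rewrite /mkseq -map_take take_iota (minn_idPl st).
case: eqP => ts; apply/seteqP; split=> x //.
- by case.
- by move=> xt; split=> //; rewrite /cylinder/= -(tk x xt).
- by move=> [xs xt]; apply: ts; rewrite (tk x xt).
Qed.

Section binary_digits.
Variable R : realType.

Let val (s : seq bool) : nat := foldl (fun k (b : bool) => (k.*2 + b)%N) 0%N s.

Let truncn_double (x : R) n : 0 <= x ->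
  (Num.truncn (x * 2 ^+ n.+1))./2 = Num.truncn (x * 2 ^+ n).
Proof.
move=> x0; apply/esym/truncn_def.
have /truncn_itv : 0 <= x * 2 ^+ n.+1 by rewrite mulr_ge0// exprn_ge0.
set t := Num.truncn _; rewrite -[in X in X -> _](odd_double_half t) exprS.
move: (t./2) => h; rewrite -muln2 -addSn !natrD !natrM -(natr1 h).
by case: (odd t) => /= /andP[]; rewrite mulrCA; set y := x * _; lra.
Qed.

Let cylinder_digits (x : R) s : 0 <= x < 1 ->
  cylinder s (binary_digits x) <-> Num.truncn (x * 2 ^+ size s) = val s.
Proof.
move=> /andP[x0 x1]; elim/last_ind: s => [|s b IH].
  split=> // _; rewrite /= expr0 mulr1; apply: truncn_def.
  by rewrite x0 x1.
have -> : cylinder (rcons s b) (binary_digits x) <->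
    cylinder s (binary_digits x) /\ binary_digits x (size s) = b.
  rewrite /cylinder/= size_rcons mkseqS; split=> [/rcons_inj[-> ->]//|[-> ->]//].
rewrite IH /val foldl_rcons -/(val s) size_rcons -truncn_double//.
rewrite /binary_digits; set t := Num.truncn _.
rewrite -{3}(odd_double_half t) addnC; split=> [[-> ->]//|].
case: (odd t) b => -[] h; split=> //; lia.
Qed.


Let cylinder_digits01 s :
  binary_digits (R := R) @^-1` cylinder s `&` `[0, 1[ =
  `[(val s)%:R / 2 ^+ size s, (val s).+1%:R / 2 ^+ size s[%classic.
Proof.
have vs : (val s < 2 ^ size s)%N.
  elim/last_ind: s => // s b; rewrite /val foldl_rcons -/(val s) size_rcons.
  by rewrite expnS; case: b; lia.
have e0 : 0 < 2 ^+ size s :> R by rewrite exprn_gt0.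
have itvE (x : R) : ((val s)%:R / 2 ^+ size s <= x < (val s).+1%:R / 2 ^+ size s)
    = ((val s)%:R <= x * 2 ^+ size s < (val s).+1%:R).
  by rewrite ler_pdivrMr// ltr_pdivlMr.
apply/seteqP; split=> x /=; rewrite !in_itv/= itvE.
  move=> -[xs /[dup] /andP[x0 _] x01].
  by rewrite -truncn_eq ?mulr_ge0 ?exprn_ge0//; apply/eqP/cylinder_digits.
move=> /[dup] /andP[h1 h2] /truncn_def xs.
have x01 : 0 <= x < 1.
  apply/andP; split.
    by rewrite -(pmulr_lge0 _ e0) (le_trans _ h1).
  by rewrite -(ltr_pM2r e0) mul1r (lt_le_trans h2)// -natrX ler_nat.
by split=> //; apply/cylinder_digits.
Qed.

Lemma measurable_binary_digits :
  measurable_fun setT (@binary_digits R).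
Proof.
apply: (@measurability _ _ _ borel_cantor _ _ (@open cantor_space)) => //.
move=> _ [A /open_bigcup_cylinder[F -> FE] <-].
rewrite setTI preimage_bigcup; apply: bigcup_measurable => k _.
have [->|[s ->]] := FE k; first by rewrite preimage_set0.
move: {F FE k A} s => s.
elim/last_ind: s => [|s b IH].
  by rewrite (_ : _ @^-1` _ = setT)//; apply/seteqP.
have -> : binary_digits (R := R) @^-1` cylinder (rcons s b) =
    binary_digits (R := R) @^-1` cylinder s `&`
    [set x | binary_digits x (size s) = b].
  apply/seteqP; split=> x; rewrite /cylinder/= size_rcons mkseqS.
    by move=> /rcons_inj[-> ->].
  by move=> [-> ->].
apply: measurableI => //.
pose y (x : R) := x * 2 ^+ (size s).+1.
have my : measurable_fun setT y by exact: mulrr_measurable.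
rewrite [X in measurable X](_ : _ = \bigcup_(k in [set k : nat | odd k = b])
    (y @^-1` [set z | Num.truncn z = k])); last first.
  apply/seteqP; split=> [x <-/=|x [k /= <- <-]//].
  by exists (Num.truncn (y x)).
apply: bigcup_measurable => k _.
rewrite -[X in measurable X]setTI; apply: my => //.
have -> : [set z : R | Num.truncn z = k] =
    `[k%:R, k.+1%:R[ `|` (if k is 0%N then `]-oo, 0[%classic else set0).
  apply/seteqP; split=> z /=.
    have [z0 <-|z0] := leP 0 z.
      by left; rewrite /= in_itv/= truncn_itv.
    have -> : Num.truncn z = 0%N.
      by apply/truncn0Pn; rewrite -ltNge (lt_trans z0).
    by move=> <-; right; rewrite /= in_itv/=.
  rewrite in_itv/= => -[/truncn_def//|]; case: k => //=; rewrite in_itv/= => z0.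
  by apply/truncn0Pn; rewrite -ltNge (lt_trans z0).
by apply: measurableU => //; case: k.
Qed.

HB.instance Definition _ := isMeasurableFun.Build _ _ (measurableTypeR R) borel_cantor
  (@binary_digits R) measurable_binary_digits.

(* The product of the uniform measures on [bool], realised as the law of the
   binary digits of a uniformly distributed real in [0, 1]; the two lemmas that
   follow show that it is the unique measure giving mass [2 ^- size s] to every
   [cylinder s]. *)
Definition cantor_measure : probability borel_cantor R :=
  @distribution _ _ _ borel_cantor R
    (uniform_prob (@ltr01 R)) (@binary_digits R).

Lemma cantor_measure_cylinder s :
  cantor_measure (cylinder s) = (2 ^- size s)%:E.
Proof.
set D := binary_digits (R := R) @^-1` cylinder s.
have mD : measurable D.
  rewrite -[D]setTI; apply: measurable_binary_digits => //.
  exact: measurable_cylinder.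
rewrite /cantor_measure/= /distribution /pushforward -/D /uniform_prob.
rewrite integral_uniform_pdf (eq_integral (cst 1%E)); last first.
  move=> x; rewrite inE => -[_] /=; rewrite in_itv/= /uniform_pdf => ->.
  by rewrite subr0 invr1.
rewrite integral_cst ?mul1e; last exact: measurableI.
set I := `[(val s)%:R / 2 ^+ size s, (val s).+1%:R / 2 ^+ size s[%classic : set R.
have DI : D `&` `[0, 1[ = I by exact: cylinder_digits01.
have e0 : 0 < 2 ^+ size s :> R by rewrite exprn_gt0.
have muI : lebesgue_measure I = (2 ^- size s)%:E.
  rewrite lebesgue_measure_itv/= lte_fin ltr_pM2r ?invr_gt0// ltr_nat ltnSn.
  by rewrite -EFinD -mulrBl -natrB// subSnn mul1r.
apply/eqP; rewrite eq_le; apply/andP; split.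
  rewrite -muI (@le_trans _ _ (lebesgue_measure (I `|` [set 1])))//.
    apply: le_measure; rewrite ?inE//.
    - exact: measurableI.
    - exact: (measurableU _ _ (measurable_itv _) (measurable_set1 _)).
    - move=> x [Dx]; rewrite /= in_itv/= => /andP[x0].
      rewrite le_eqVlt => /predU1P[->|x1]; first by right.
      by left; rewrite -DI; split=> //=; rewrite in_itv/= x0.
  rewrite (le_trans (measureU2 _ _ _))//; first exact: measurable_itv.
  rewrite [X in (_ + X)%E](_ : _ = 0%E) ?adde0//.
  exact: lebesgue_measure_set1.
rewrite -muI -DI; apply: le_measure; rewrite ?inE//.
- exact: measurableI.
- exact: measurableI.
- by apply: setIS => x /=; rewrite !in_itv/= => /andP[-> /ltW].
Qed.

Lemma cantor_measure_unique (mu : {measure set borel_cantor -> \bar R}) :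
  (forall s, mu (cylinder s) = (2 ^- size s)%:E) ->
  forall A : set borel_cantor, measurable A -> mu A = cantor_measure A.
Proof.
move=> mus A mA.
pose G := [set B : set borel_cantor | B = set0 \/ exists s, B = cylinder s].
have cyl0 : cylinder [::] = setT by apply/seteqP.
apply: (measure_unique G (fun=> setT)) => //.
- apply/seteqP; split.
    apply: smallest_sub; first exact: smallest_sigma_algebra.
    move=> B /open_bigcup_cylinder[F -> FE].
    by apply: sigma_algebra_bigcup => k; apply: sub_sigma_algebra; exact: FE.
  apply: smallest_sub; first exact: sigma_algebra_measurable.
  by move=> B [->//|[s ->]]; exact: measurable_cylinder.
- move=> B C [->|[s ->]]; first by rewrite set0I; left.
  move=> [->|[t ->]]; first by rewrite setI0; left.
  have [st|/ltnW st] := leqP (size s) (size t).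
    by rewrite cylinderI//; case: ifP => _; [right; exists t|left].
  by rewrite setIC cylinderI//; case: ifP => _; [right; exists s|left].
- by right; exists [::].
- by rewrite bigcup_const.
- move=> B [->|[s ->]]; first by rewrite !measure0.
  by rewrite mus; exact/esym/cantor_measure_cylinder.
- by move=> _; rewrite -cyl0 mus ltry.
Qed.
End binary_digits.

Definition closure_measure_zero (R : realType) : set (set cantor_space) :=
  [set A | cantor_measure R (closure A) = 0%E].

Lemma cantor_closure1 (x : cantor_space) : closure [set x] = [set x].
Proof.
apply/esym/closure_id; apply: accessible_closed_set1.
exact/hausdorff_accessible/cantor_space_hausdorff.
Qed.

Lemma yorioka0_subset_closed (f : nat -> nat) :
  {homo f : m n / (m < n)%N} -> subset_closed_with_points (yorioka0 f).
Proof.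
move=> f_inc; split=> [A B AB [sigma [Bs fs]]|x].
  by exists sigma; split=> //; exact: subset_trans (closureS AB) Bs.
rewrite /yorioka0/= cantor_closure1.
exists (fun i => mkseq x (f (i ^ i)%N)); split=> [_ -> n _|k].
  by exists n => /=; rewrite ?leqnn//; exact: cylinder_mkseq.
exists (maxn 1 k) => //= i /=; rewrite geq_max => /andP[i0 ki].
rewrite /ht size_mkseq; have := leq_pexp2l i0 ki.
by rewrite leq_eqVlt => /predU1P[->//|/f_inc/ltnW].
Qed.

Lemma closure_measure_zero_subset_closed (R : realType) :
  subset_closed_with_points (closure_measure_zero R).
Proof.
have mcl (A : set cantor_space) : measurable (closure A : set borel_cantor).
  rewrite -[closure A]setCK; apply: measurableC; apply: sub_sigma_algebra.
  by apply: closed_openC; exact: closed_closure.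
split=> [A B AB B0|x].
  by apply: (subset_measure0 (mcl A) (mcl B)) => //; exact: closureS.
apply/eqP; rewrite /closure_measure_zero/= eq_le measure_ge0 andbT.
apply/lee_addgt0Pr => e e0; rewrite add0e.
have [n ne] : exists n, 2 ^- n < e.
  have : `|2^-1 : R| < 1 by rewrite ger0_norm ?invr_ge0// invf_lt1// ltr1n.
  move=> /cvg_expr/cvgrPdist_lt/(_ _ e0)[n _ /(_ n (leqnn n))] ne.
  exists n; rewrite -exprVn; apply: le_lt_trans ne.
  by rewrite sub0r normrN ler_norm.
rewrite (@le_trans _ _ (cantor_measure R (cylinder (mkseq x n))))//.
  apply: (le_measure (cantor_measure R)); rewrite ?inE; first exact: mcl.
    exact: measurable_cylinder.
  by rewrite cantor_closure1 => _ ->; exact: cylinder_mkseq.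
by rewrite cantor_measure_cylinder size_mkseq lee_fin ltW.
Qed.

Lemma nowhere_dense_subset_closed :
  subset_closed_with_points nowhere_dense.
Proof.
split=> [A B AB B0|x].
  apply/seteqP; split=> // y; rewrite -[in X in _ -> X]B0.
  by apply: interiorS; exact: closureS.
rewrite /nowhere_dense/= cantor_closure1; apply/seteqP; split=> // y.
move=> /nbhs_cylinderP[n yx].
have h b : (fun i => if (i < n)%N then y i else b) = x.
  by apply: yx; apply/cylinderP => i; rewrite size_mkseq => ni; rewrite ni nth_mkseq.
by have := congr1 (@^~ n) (etrans (h true) (esym (h false))); rewrite ltnn.
Qed.

(* Main.v *)
Require Import Defs.
From HB Require Import structures.
From mathcomp Require Import all_boot all_order all_algebra.
From mathcomp Require Import all_classical all_reals all_analysis.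
Set Implicit Arguments.
Unset Strict Implicit.
Unset Printing Implicit Defensive.
Import Order.TTheory GRing.Theory Num.Theory.
Import numFieldNormedType.Exports.
Local Open Scope classical_set_scope.
Local Open Scope ring_scope.

(** The idea is to record the points [F i] of the Cantor space with a precision
    [h n] that grows very fast with [n].  Cutting [nat] according to the first
    [h n] bits of [F i] gives, for each [n], a partition into finitely many
    pieces, so a Laver ultrafilter contains an [x] such that the points of
    [F @` x] have at most [n + 1] initial segments of length [h n], for all [n]
    at once ([laver_card_image]).

    Listing these initial segments, one block of indices for each [n], yields a
    single sequence [sigma].  As cylinders are open, a point of the closure of
    [F @` x] agrees up to [h n] with a point of [F @` x], and hence lies in a
    cylinder of every block: the closure is contained in the limsup of the
    cylinders of [sigma].  An index in block [n] is smaller than [2 ^ n.+1], a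
    bound that does not depend on [h], so [h] can be chosen to make [sigma]
    dominate [f] ([laver_yorioka0]).

    Domination of a strictly increasing [f] makes the measures of the cylinders
    summable, so Borel-Cantelli shows that the sets in [yorioka f] are null
    ([lim_sup_cylinder_null]); and a set with null closure is nowhere dense,
    because every nonempty open set contains a cylinder, which has positive
    measure. *)

Lemma ideal_ultrafilterS (X : Type) (I J : set (set X)) (U : set_system nat) :
  I `<=` J -> ideal_ultrafilter I U -> ideal_ultrafilter J U.
Proof.
move=> IJ [Unp IU]; split=> // F.
by have [x Ux /IJ] := IU F; exists x.
Qed.

Lemma fibers_partition (T : Type) (r : nat -> T) :
  partition (range (fun i => r @^-1` [set r i])) id [set: nat].
Proof.
split=> [|A B [i _ <-] [j _ <-] [k [/= <- <-]]//|A [i _ <-]]; last by exists i.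
by apply/seteqP; split=> // k _; exists (r @^-1` [set r k]) => //; exists k.
Qed.

(** Apply the Laver property to the partitions of [nat] into the fibers of the
    [r n]: distinct values of [r n] on [x] have distinct fibers, all met by [x]. *)
Lemma laver_card_image (U : set_system nat) (T : Type) (r : nat -> nat -> T) :
  laver_ultrafilter U -> (forall n, finite_set (range (r n))) ->
  exists2 x, U x & forall n, (r n @` x #<= `I_n.+1)%card.
Proof.
move=> [_ laverU] rfin.
have [|x Ux xP] := laverU (fun n => range (fun i => r n @^-1` [set r n i])).
  move=> n; split; last exact: fibers_partition.
  rewrite -(image_comp (r n) (fun t => r n @^-1` [set t])).
  exact: finite_image.
exists x => // n; apply: card_le_trans (xP n).
have fiber_inj : {in r n @` x &, injective (fun t => r n @^-1` [set t])}.
  move=> _ t /set_mem[i _ <-] _ rt.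
  by have : (r n @^-1` [set r n i]) i by []; rewrite rt.
rewrite -(card_le_eql (inj_card_eq fiber_inj)).
by apply: subset_card_le => _ [_ [i xi <-] <-]; split; exists i.
Qed.

Lemma finite_range_mkseq (F : nat -> cantor_space) n :
  finite_set (range (fun i => mkseq (F i) n)).
Proof.
apply: (@sub_finite_set _ _ (range (val : n.-tuple bool -> seq bool))).
  by move=> _ [i _ <-]; exists (Tuple (introT eqP (size_mkseq (F i) n))).
exact: finite_image.
Qed.

(** Block [n] of the enumeration of the [C n j] consists of the [2 ^ n] indices
    from [2 ^ n] to [2 ^ n.+1 - 1], those [m] with [trunc_log 2 m = n]; as
    [n < 2 ^ n], it has room for the sets [C n j] with [j <= n].  A point lying
    in a set of every block lies in infinitely many sets of the enumeration. *)
Lemma lim_sup_set_blocks (T : Type) (C : nat -> nat -> set T) (y : T) :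
  (forall n, exists2 j, (j < n.+1)%N & C n j y) ->
  lim_sup_set (fun m => C (trunc_log 2 m) (m - 2 ^ trunc_log 2 m)%N) y.
Proof.
move=> Cy n _; have [j jn Cj] := Cy n.
have j2 : (j < 2 ^ n)%N by rewrite (leq_trans jn)// ltn_expl.
have log : trunc_log 2 (2 ^ n + j) = n.
  by apply: trunc_log_eq => //; rewrite leq_addr expnS mul2n -addnn ltn_add2l.
exists (2 ^ n + j)%N => /=; last by rewrite log addKn.
by rewrite (leq_trans _ (leq_addr _ _))// ltnW// ltn_expl.
Qed.

(** Growth of [f] costs nothing: the Laver property bounds the number of initial
    segments by [n + 1] whatever their length [h n], so [h] can be chosen after
    the enumeration that turns the blocks into one sequence. *)
Lemma laver_yorioka0 (U : set_system nat) (f : nat -> nat) :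
  laver_ultrafilter U -> {homo f : m n / (m <= n)%N} ->
  ideal_ultrafilter (yorioka0 f) U.
Proof.
move=> laverU f_mono; split; first exact: laverU.1.
move=> F.
(* An index [m] of block [n] satisfies [m ^ k <= (2 ^ n.+1) ^ n] once [k <= n]. *)
pose h n := f ((2 ^ n.+1) ^ n)%N.
have [x Ux xP] := laver_card_image laverU
  (fun n => finite_range_mkseq F (h n)).
exists x => //.
have /choice[g gP] : forall n, exists g : nat -> seq bool,
    set_surj `I_n.+1 ((fun i => mkseq (F i) (h n)) @` x) g.
  move=> n; have /pfcard_geP[->|[g]] := xP n; first by exists (fun=> [::]).
  by exists g; exact: surj.
(* Forcing [g n j] to length [h n] gives [sigma] its exact height even where
   [g n j] is not an initial segment of some [F i]. *)
pose s n j := mkseq (nth false (g n j)) (h n).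
pose sigma m := s (trunc_log 2 m) (m - 2 ^ trunc_log 2 m)%N.
exists sigma; split=> [y yx|k].
  apply: (lim_sup_set_blocks (C := fun n j => cylinder (s n j))) => n.
  have [_ [[i xi <-] yi]] := yx _ (nbhs_cylinder y (h n)).
  rewrite /cylinder/= size_mkseq in yi.
  have [|j jn gj] := gP n (mkseq (F i) (h n)); first by exists i.
  exists j => //; rewrite /s gj yi -[in X in mkseq _ X](size_mkseq y (h n)).
  by rewrite mkseq_nth; exact: cylinder_mkseq.
exists (2 ^ k)%N => //= m km; rewrite /ht size_mkseq; apply: f_mono.
have kn : (k <= trunc_log 2 m)%N by exact: trunc_log_max.
rewrite (@leq_trans ((2 ^ (trunc_log 2 m).+1) ^ k)%N)//.
  have [->//|k0] := posnP k.
  by rewrite leq_exp2r// ltnW// trunc_log_ltn.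
by rewrite leq_pexp2l// expn_gt0.
Qed.

(** Borel-Cantelli, with the geometric series as majorant. *)
Lemma lim_sup_cylinder_null (R : realType) (sigma : nat -> seq bool) :
  eventually_le id (ht sigma) ->
  cantor_measure R (lim_sup_set (fun m => cylinder (sigma m))) = 0%E.
Proof.
move=> [N _ sigmaN]; pose G m := cylinder (sigma (m + N)%N) : set borel_cantor.
have mG m : measurable (G m) by exact: measurable_cylinder.
have G0 : cantor_measure R (lim_sup_set G) = 0%E.
  apply: lim_sup_set_cvg0 => //.
  apply: (@le_lt_trans _ _ (\sum_(m <oo) (2 / (2 ^ (m + 1))%:R : R)%:E)%E).
    apply: lee_nneseries => // m _.
    have mN : (m + N <= ht sigma (m + N))%N.
      by apply: sigmaN; rewrite /= leq_addl.
    apply: (@le_trans _ _ (2 ^- ht sigma (m + N))%:E).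
      by rewrite -(cantor_measure_cylinder R).
    rewrite lee_fin natrX exprD expr1 invfM mulrCA divff// mulr1.
    rewrite lef_pV2 ?posrE ?exprn_gt0// ler_eXn2l ?ltr1n//.
    by rewrite (leq_trans _ mN)// leq_addr.
  by rewrite (cvg_lim _ (@cvg_geometric_eseries_half R 2 0))// ltry.
have -> // : lim_sup_set (fun m => cylinder (sigma m)) = lim_sup_set G.
apply/seteqP; split=> y ys n _.
  have [m /= nm ym] := ys (n + N)%N Logic.I.
  exists (m - N)%N.
    by rewrite /= leq_subRL ?(leq_trans (leq_addl n N))// addnC.
  by rewrite /G subnK// (leq_trans (leq_addl n N)).
have [m /= nm ym] := ys n Logic.I.
by exists (m + N)%N => //=; rewrite (leq_trans nm) ?leq_addr.
Qed.

Lemma measurable_closure_cantor (A : set cantor_space) :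
  measurable (closure A : set borel_cantor).
Proof.
rewrite -[closure A]setCK; apply: measurableC; apply: sub_sigma_algebra.
by apply: closed_openC; exact: closed_closure.
Qed.

Lemma yorioka0_null (R : realType) (f : nat -> nat) :
  {homo f : m n / (m < n)%N} -> yorioka0 f `<=` closure_measure_zero R.
Proof.
move=> f_inc A [sigma [Asigma fsigma]].
have f_ge n : (n <= f n)%N.
  by elim: n => // n IH; rewrite (leq_ltn_trans IH)// f_inc.
have sigma0 : eventually_le id (ht sigma).
  apply: filterS (fsigma 1%N) => m /=; rewrite expn1.
  exact: leq_trans (f_ge m).
apply: subset_measure0 (lim_sup_cylinder_null R sigma0) => //.
- exact: measurable_closure_cantor.
- apply: bigcap_measurable => // n _; apply: bigcup_measurable => m _.
  exact: measurable_cylinder.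
Qed.

Lemma null_nowhere_dense (R : realType) :
  closure_measure_zero R `<=` nowhere_dense.
Proof.
move=> A A0; apply/seteqP; split=> // y /nbhs_cylinderP[n yA].
have : cantor_measure R (cylinder (mkseq y n)) = 0%E.
  apply: subset_measure0 A0 => //; first exact: measurable_cylinder.
  exact: measurable_closure_cantor.
by move/eqP; rewrite cantor_measure_cylinder eqe gt_eqF// invr_gt0 exprn_gt0.
Qed.

Theorem corollary3p8 (R : realType) (U : set_system nat) :
  laver_ultrafilter U ->
  [/\ forall f : nat -> nat, {homo f : m n / (m < n)%N} ->
        ideal_ultrafilter (yorioka0 f) U,
      ideal_ultrafilter (closure_measure_zero R) U &
      ideal_ultrafilter nowhere_dense U].
Proof.
move=> laverU.
have yoriokaU f : {homo f : m n / (m < n)%N} -> ideal_ultrafilter (yorioka0 f) U.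
  by move=> f_inc; apply: laver_yorioka0 => //; exact: ltnW_homo.
have nullU : ideal_ultrafilter (closure_measure_zero R) U.
  by apply: ideal_ultrafilterS (yoriokaU id _) => //; exact: yorioka0_null.
by split=> //; exact: ideal_ultrafilterS (@null_nowhere_dense R) nullU.
Qed.
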